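(* In the source coding problem with receiver side information described in the context, suppose $U=Y$ and $V=X$ (i.e. $U_i=Y_i$ and $V_i=X_i$ for all $i$). Then the set $\mathcal{R}$ of achievable rate triples equals the closure of $\bigcup_{p\in\mathcal{P}^{**}}\mathcal{R}^{(p)**}$.
   Context: Let $\mathcal{X},\mathcal{Y},\mathcal{U},\mathcal{V}$ be finite sets and let $\{(X_i,Y_i,U_i,V_i)\}_{i\ge1}$ be i.i.d. with joint distribution $\mathcal{Q}_{XYUV}$, with $(X,Y)$-marginal $\mathcal{Q}_{XY}$. For $i=0,1,2$ let $\mathcal{M}_i=\{1,\dots,|\mathcal{M}_i|\}$ be finite index sets. A code of block length $n$ consists of an encoder $e^{(n)}:\mathcal{X}^n\times\mathcal{Y}^n\to\mathcal{M}_0\times\mathcal{M}_1\times\mathcal{M}_2$, $(M_0,M_1,M_2)=e^{(n)}(X^n,Y^n)$, a decoder $d_x^{(n)}:\mathcal{M}_0\times\mathcal{M}_1\times\mathcal{U}^n\to\mathcal{X}^n$, $\widehat X^n=d_x^{(n)}(M_0,M_1,U^n)$, and a decoder $d_y^{(n)}:\mathcal{M}_0\times\mathcal{M}_2\times\mathcal{V}^n\to\mathcal{Y}^n$, $\widehat Y^n=d_y^{(n)}(M_0,M_2,V^n)$. Let $P_e=\max\{\Pr[\widehat X^n\ne X^n],\Pr[\widehat Y^n\ne Y^n]\}$. A triple $(R_0,R_1,R_2)$ is achievable if for every $\epsilon>0$ and all sufficiently large $n$ there is such a code with $P_e\le\epsilon$ and $(1/n)\log_2|\mathcal{M}_i|\le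 R_i+\epsilon$, $i=0,1,2$; $\mathcal{R}$ is the set of achievable triples. Let $\mathcal{A},\mathcal{B}$ be finite sets with $|\mathcal{A}|\le|\mathcal{X}||\mathcal{Y}|+1$, $|\mathcal{B}|\le|\mathcal{X}||\mathcal{Y}|+1$. Let $\mathcal{P}^{**}$ be the set of probability functions $p$ on $\mathcal{A}\times\mathcal{B}\times\mathcal{X}\times\mathcal{Y}$ such that $\sum_{(a,b)\in\mathcal{A}\times\mathcal{B}}p(a,b,x,y)=\mathcal{Q}_{XY}(x,y)$ for all $(x,y)$. For $p\in\mathcal{P}^{**}$ let $\mathcal{R}^{(p)**}$ be the set of $(R_0,R_1,R_2)$ with $R_0\ge\max\{H_p(X|A,Y),H_p(Y|B,X)\}$, $R_1\ge I_p(X;A|Y)$, $R_2\ge I_p(Y;B|X)$. *)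

(* Defs.v *)
From HB Require Import structures.
From mathcomp Require Import all_boot all_order all_algebra.
From mathcomp Require Import all_classical all_reals.
From mathcomp Require Import topology normedtype exp.
Set Implicit Arguments. Unset Strict Implicit. Unset Printing Implicit Defensive.
Import Order.TTheory GRing.Theory Num.Theory.
Import numFieldNormedType.Exports.
Local Open Scope ring_scope.

Section InfoTheory.
Context {R : realType}.

Definition log2 (x : R) : R := ln x / ln 2.

Definition entterm (pj pc : R) : R :=
  if pj == 0 then 0 else - (pj * log2 (pj / pc)).

Variables (A B X Y : finType).
Implicit Type p : A -> B -> X -> Y -> R.

Definition pAXY p a x y : R := \sum_(b : B) p a b x y.
Definition pAY p a y : R := \sum_(x : X) pAXY p a x y.
Definition pBXY p b x y : R := \sum_(a : A) p a b x y.
Definition pBX p b x : R := \sum_(y : Y) pBXY p b x y.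
Definition pXY p x y : R := \sum_(a : A) \sum_(b : B) p a b x y.
Definition pY p y : R := \sum_(x : X) pXY p x y.
Definition pX p x : R := \sum_(y : Y) pXY p x y.

Definition H_X_AY p : R :=
  \sum_(a : A) \sum_(x : X) \sum_(y : Y) entterm (pAXY p a x y) (pAY p a y).
Definition H_Y_BX p : R :=
  \sum_(b : B) \sum_(x : X) \sum_(y : Y) entterm (pBXY p b x y) (pBX p b x).
Definition H_X_Y p : R := \sum_(x : X) \sum_(y : Y) entterm (pXY p x y) (pY p y).
Definition H_Y_X p : R := \sum_(x : X) \sum_(y : Y) entterm (pXY p x y) (pX p x).

Definition I_XA_Y p : R := H_X_Y p - H_X_AY p.
Definition I_YB_X p : R := H_Y_X p - H_Y_BX p.

Definition Pstarstar (Q : X -> Y -> R) p : Prop :=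
  (forall a b x y, 0 <= p a b x y) /\
  (forall x y, \sum_(a : A) \sum_(b : B) p a b x y = Q x y).

Definition Rp_starstar p : set (R * R * R) :=
  [set r | Num.max (H_X_AY p) (H_Y_BX p) <= r.1.1 /\
           I_XA_Y p <= r.1.2 /\ I_YB_X p <= r.2].
End InfoTheory.

Section Coding.
Context {R : realType} {X Y : finType}.

Definition iidQ (Q : X -> Y -> R) n (xs : n.-tuple X) (ys : n.-tuple Y) : R :=
  \prod_(i < n) Q (tnth xs i) (tnth ys i).

(* Code with U = Y, V = X:
   encoder e : X^n x Y^n -> M0 x M1 x M2,
   decoder dx : M0 x M1 x Y^n -> X^n, decoder dy : M0 x M2 x X^n -> Y^n,
   with M_i = 'I_(k_i) = {1..|M_i|} (up to relabeling). *)
Definition err_x (Q : X -> Y -> R) n k0 k1 k2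
  (e : n.-tuple X -> n.-tuple Y -> 'I_k0 * 'I_k1 * 'I_k2)
  (dx : 'I_k0 -> 'I_k1 -> n.-tuple Y -> n.-tuple X) : R :=
  \sum_(xs : n.-tuple X) \sum_(ys : n.-tuple Y)
     iidQ Q xs ys * (dx (e xs ys).1.1 (e xs ys).1.2 ys != xs)%:R.

Definition err_y (Q : X -> Y -> R) n k0 k1 k2
  (e : n.-tuple X -> n.-tuple Y -> 'I_k0 * 'I_k1 * 'I_k2)
  (dy : 'I_k0 -> 'I_k2 -> n.-tuple X -> n.-tuple Y) : R :=
  \sum_(xs : n.-tuple X) \sum_(ys : n.-tuple Y)
     iidQ Q xs ys * (dy (e xs ys).1.1 (e xs ys).2 xs != ys)%:R.

Definition achievable (Q : X -> Y -> R) (r : R * R * R) : Prop :=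
  forall eps : R, 0 < eps -> exists N : nat, forall n : nat, (N <= n)%N ->
    exists (k0 k1 k2 : nat)
      (e : n.-tuple X -> n.-tuple Y -> 'I_k0 * 'I_k1 * 'I_k2)
      (dx : 'I_k0 -> 'I_k1 -> n.-tuple Y -> n.-tuple X)
      (dy : 'I_k0 -> 'I_k2 -> n.-tuple X -> n.-tuple Y),
      Num.max (err_x Q e dx) (err_y Q e dy) <= eps /\
      n%:R^-1 * log2 k0%:R <= r.1.1 + eps /\
      n%:R^-1 * log2 k1%:R <= r.1.2 + eps /\
      n%:R^-1 * log2 k2%:R <= r.2 + eps.

Definition achievable_region (Q : X -> Y -> R) : set (R * R * R) :=
  [set r | achievable Q r].

Definition union_region (Q : X -> Y -> R) : set (R * R * R) :=
  [set r | exists (a b : nat), (a <= #|X| * #|Y| + 1)%N /\ (b <= #|X| * #|Y| + 1)%N /\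
     exists p : 'I_a -> 'I_b -> X -> Y -> R,
       Pstarstar Q p /\ Rp_starstar p r].
End Coding.

(* Main.v *)
(* Both sides equal the polyhedron of triples of nonnegative rates with
   [R0 + R1 >= H(X|Y)] and [R0 + R2 >= H(Y|X)].
   For the union, conditioning reduces entropy in one direction; in the other,
   taking for [A] (resp. [B]) an erased copy of [X] (resp. [Y]) gives
   [H(X|A,Y) = l H(X|Y)] for any erasure probability [l], which realizes every
   split of [H(X|Y)] between [R0] and [R1].
   For the achievable triples, [M0] is a random bin index of the pair
   [(X^n, Y^n)]: each receiver knows one component, so the same [R0] bits serve
   both.  The converse counts the sequences that a receiver can recover.  In
   both directions the conditional probabilities are controlled by Chebyshev's
   inequality for the information density [- ln (Q(x,y) / Q(y))]. *)

Require Import Defs.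
From HB Require Import structures.
From mathcomp Require Import all_boot all_order all_algebra.
From mathcomp Require Import all_classical all_reals.
From mathcomp Require Import topology normedtype exp.
From mathcomp Require Import sequences ring lra.
Import Order.TTheory GRing.Theory Num.Theory.
Import numFieldNormedType.Exports.
Local Open Scope ring_scope.
Set Implicit Arguments.
Unset Strict Implicit.
Unset Printing Implicit Defensive.

(** * One-shot converse for a decoder with side information *)

Section OneShot.
Context {R : realType} {S T : finType}.
Variable P : S -> T -> R.
Hypothesis P_ge0 : forall s t, 0 <= P s t.

Definition sndmarg (t : T) : R := \sum_s P s t.

Definition prob (A : S -> T -> bool) : R := \sum_s \sum_t P s t * (A s t)%:R.

Lemma prob_le (A B : S -> T -> bool) :
  (forall s t, 0 < P s t -> A s t -> B s t) -> prob A <= prob B.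
Proof.
move=> AB; apply: ler_sum => s _; apply: ler_sum => t _.
have [/AB sAB|] := boolP (0 < P s t).
  by rewrite ler_wpM2l// ler_nat; case: (A s t) sAB => // ->.
by rewrite lt_neqAle P_ge0 andbT negbK => /eqP <-; rewrite !mul0r.
Qed.

Lemma sum_sndmarg : \sum_t sndmarg t = \sum_s \sum_t P s t.
Proof. by rewrite exchange_big. Qed.

(* A decoder that sees [t] recovers at most one [s] per message, so at most
   [k0 * k1] of the [s] are decoded correctly, each of mass at most
   [c * sndmarg t] unless atypical. *)
Lemma one_shot_converse (k0 k1 : nat) (f : S -> T -> 'I_k0 * 'I_k1)
    (d : 'I_k0 -> 'I_k1 -> T -> S) (c : R) :
  0 <= c -> \sum_s \sum_t P s t = 1 ->
  1 <= prob (fun s t => d (f s t).1 (f s t).2 t != s)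
       + prob (fun s t => sndmarg t * c < P s t) + (k0 * k1)%:R * c.
Proof.
move=> c0 P1.
(* Spreading this term over all sources, side informations and messages reduces the claim to a
   comparison for each pair [s], [t]. *)
have -> : (k0 * k1)%:R * c =
    \sum_s \sum_t \sum_(m : 'I_k0 * 'I_k1) sndmarg t * c * (d m.1 m.2 t == s)%:R.
  rewrite exchange_big/=.
  under eq_bigr => t _.
    rewrite exchange_big/=.
    under eq_bigr => m _.
      rewrite -big_distrr/= (bigD1 (d m.1 m.2 t))//= eqxx big1; last first.
        by move=> s /negPf; rewrite eq_sym => ->.
      over.
    rewrite sumr_const card_prod !card_ord addr0 mulr1 -(mulr_natl (_ * c)).
    over.
  by rewrite /= -big_distrr -big_distrl /= sum_sndmarg P1 mul1r.
rewrite -[leLHS]P1 -!big_split/=; apply: ler_sum => s _.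
rewrite -!big_split/=; apply: ler_sum => t _.
have M0 (m : 'I_k0 * 'I_k1) : 0 <= sndmarg t * c * (d m.1 m.2 t == s)%:R.
  by do !apply: mulr_ge0 => //; apply: sumr_ge0.
case: eqP => [E|_] /=; last first.
  by rewrite mulr1 -addrA lerDl addr_ge0 ?mulr_ge0 ?sumr_ge0 ?ler0n.
rewrite mulr0 add0r; case: ltP => [_|PM].
  by rewrite mulr1 lerDl sumr_ge0.
rewrite mulr0 add0r (bigD1 (f s t))//= E eqxx mulr1.
by rewrite (le_trans PM)// lerDl sumr_ge0.
Qed.

End OneShot.

(** * Collision probability of a uniformly random codebook *)

Section Hash.
Context {R : realType} {W M C : finType}.
Variables (h : M -> C) (k : nat).
Hypothesis h_bal : forall c, #|[pred m | h m == c]| = k.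

Lemma card_hash : #|M| = (#|C| * k)%N.
Proof.
rewrite -sum1_card (partition_big h xpredT)//=.
under eq_bigr => c _ do rewrite sum1_card h_bal.
by rewrite sum_nat_const.
Qed.

(** Under a uniform random [E], the values [E u] and [E v] are independent, and balance makes their
    images under [h] uniform on [C]. Collisions therefore have probability [1 / #|C|]. *)
Lemma sum_hash_collision (u v : W) : u != v ->
  \sum_(E : {ffun W -> M}) (h (E u) == h (E v))%:R * #|C|%:R
  = #|{ffun W -> M}|%:R :> R.
Proof.
move=> uv.
(* The event that both hashes equal [c] becomes a product over all words. The factor [#|C|] makes
   every coordinate sum to [#|M|], constrained or not. *)
pose G c (w : W) (m : M) : R :=
  if (w == u) || (w == v) then (h m == c)%:R * #|C|%:R else 1.
have GE (E : {ffun W -> M}) :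
    (h (E u) == h (E v))%:R * #|C|%:R ^+ 2 = \sum_c \prod_w G c w (E w).
  have prodG c : \prod_w G c w (E w) = (h (E u) == c)%:R * (h (E v) == c)%:R * #|C|%:R ^+ 2.
    have vu : v != u by rewrite eq_sym.
    rewrite (bigD1 u)//= (bigD1 v)//= big1; last first.
      by move=> w /andP[/negPf wu /negPf wv]; rewrite /G wu wv.
    by rewrite /G !eqxx orbT /=; ring.
  under eq_bigr do rewrite prodG.
  rewrite -big_distrl/= (bigD1 (h (E u)))//= eqxx mul1r big1 ?addr0.
    by rewrite eq_sym.
  by move=> c /negPf; rewrite eq_sym => ->; rewrite mul0r.
have sumG c w : \sum_m G c w m = #|M|%:R.
  rewrite /G; case: (_ || _); last by rewrite sumr_const.
  have hc : \sum_m (h m == c)%:R = k%:R :> R.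
    rewrite -(h_bal c) -sum1_card natr_sum [RHS]big_mkcond/=.
    by apply: eq_bigr => m _; rewrite inE; case: eqP.
  by rewrite -(big_distrl (#|C|%:R : R))/= hc card_hash -natrM mulnC.
have [C0|C0] := posnP #|C|.
  have M0 : #|M| = 0%N by rewrite card_hash C0.
  rewrite [RHS](_ : _ = 0); last first.
    by rewrite card_ffun M0 exp0n//; apply/card_gt0P; exists u.
  by rewrite big1// => E _; rewrite C0 mulr0.
have C0' : #|C|%:R != 0 :> R by rewrite pnatr_eq0 -lt0n.
apply: (mulIf C0').
rewrite big_distrl/=.
under eq_bigr do rewrite -mulrA -expr2 GE.
rewrite exchange_big/=.
under eq_bigr => c _.
  rewrite -(bigA_distr_bigA (G c)) /=.
  under eq_bigr do rewrite sumG.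
  rewrite prodr_const.
  over.
by rewrite sumr_const card_ffun natrX mulr_natr.
Qed.

End Hash.

(** * Random binning with a threshold decoder *)

Section Binning.
Context {R : realType} {S T W M C : finType}.
Variable P : S -> T -> R.
Hypothesis P_ge0 : forall s t, 0 <= P s t.
Variables (h : M -> C) (k : nat).
Hypothesis h_bal : forall c, #|[pred m | h m == c]| = k.
Variables (g : S -> T -> W) (s0 : S).
Hypothesis g_inj : forall t, injective (g^~ t).

(** [E] assigns a full message to the word [g s t], of which the receiver sees only the part [h];
    receivers with different [h] and [g] can thus share one codebook. [s0] is returned when no
    candidate exists. *)
Definition bin_decode (c : R) (E : {ffun W -> M}) (m : C) (t : T) : S :=
  odflt s0 [pick s | (sndmarg P t * c <= P s t) && (h (E (g s t)) == m)].

(** Union bound: a failure means that [s] itself is below the threshold, or that some other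
    candidate falls into the same bin. *)
Lemma bin_decode_error c E s t :
  (bin_decode c E (h (E (g s t))) t != s)%:R <=
  (P s t < sndmarg P t * c)%R%:R
  + \sum_(s' | s' != s)
      (sndmarg P t * c <= P s' t)%R%:R * (h (E (g s' t)) == h (E (g s t)))%:R :> R.
Proof.
have S0 (s1 : S) : 0 <= (sndmarg P t * c <= P s1 t)%R%:R * (h (E (g s1 t)) == h (E (g s t)))%:R :> R.
  by rewrite mulr_ge0.
case: eqP => [_|D]; first by rewrite addr_ge0// sumr_ge0.
case: ltP => [_|Pst]; first by rewrite lerDl sumr_ge0.
rewrite add0r; move: D; rewrite /bin_decode; case: pickP => [s'|]; last first.
  by move=> /(_ s); rewrite Pst eqxx.
move=> /andP[Ps' Es'] /= /eqP s's.
by rewrite (bigD1 s')//= Ps' Es' mulr1 lerDl sumr_ge0.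
Qed.

(** Averaging the union bound over all codebooks: each wrong candidate collides with probability
    [1 / #|C|], and there are at most [c^-1] candidates. *)
Lemma sum_bin_decode_error (c : R) : 0 < c -> (0 < #|C|)%N ->
  \sum_s \sum_t P s t = 1 ->
  \sum_(E : {ffun W -> M})
     prob P (fun s t => bin_decode c E (h (E (g s t))) t != s)
  <= #|{ffun W -> M}|%:R *
     (prob P (fun s t => P s t < sndmarg P t * c) + (c * #|C|%:R)^-1).
Proof.
move=> c0 C0 P1; set N : R := #|{ffun W -> M}|%:R.
have C0' : 0 < #|C|%:R :> R by rewrite ltr0n.
have marg0 t : 0 <= sndmarg P t by rewrite sumr_ge0.
(* At most [c^-1] of the [s] are candidates for a given [t]. *)
have list_le t : sndmarg P t * \sum_s (sndmarg P t * c <= P s t)%R%:R <= c^-1 * sndmarg P t.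
  rewrite ler_pdivlMl// mulrA (mulrC c) big_distrr/=; apply: ler_sum => s _.
  by case: (leP (_ * c)) => [leP|_]; rewrite ?mulr1 ?mulr0.
apply: (@le_trans _ _ (\sum_s \sum_t P s t * (N * (P s t < sndmarg P t * c)%R%:R
   + \sum_(s' | s' != s) (sndmarg P t * c <= P s' t)%R%:R * (N / #|C|%:R)))).
  rewrite exchange_big; apply: ler_sum => s _ /=.
  rewrite exchange_big; apply: ler_sum => t _ /=.
  rewrite -big_distrr/= ler_wpM2l//.
  apply: (le_trans (ler_sum _ (fun E _ => bin_decode_error c E s t))).
  rewrite big_split/= sumr_const -[X in X + _]mulr_natl lerD2l.
  rewrite exchange_big/=; apply: ler_sum => s' s's.
  rewrite -big_distrr/= ler_wpM2l// ler_pdivlMr// big_distrl/=.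
  rewrite (sum_hash_collision h_bal)//.
  by apply: contraNneq s's => /g_inj ->.
rewrite mulrDr.
(* Readmitting [s' = s] makes the inner sum independent of [s], so that summing over [s] produces
   the marginal. *)
apply: (@le_trans _ _ (\sum_s \sum_t (N * (P s t * (P s t < sndmarg P t * c)%R%:R)
   + P s t * (N / #|C|%:R * \sum_s' (sndmarg P t * c <= P s' t)%R%:R)))).
  apply: ler_sum => s _; apply: ler_sum => t _.
  rewrite mulrDr mulrCA lerD2l ler_wpM2l// -big_distrl/= mulrC ler_wpM2l ?divr_ge0 ?ler0n//.
  by rewrite [leRHS](bigD1 s)//= lerDr.
rewrite exchange_big/=.
under eq_bigr do rewrite big_split/=.
rewrite big_split/= exchange_big/= lerD//.
  by rewrite /prob big_distrr/=; apply: ler_sum => s _; rewrite big_distrr.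
apply: (@le_trans _ _ (\sum_t (N / #|C|%:R) * (c^-1 * sndmarg P t))).
  apply: ler_sum => t _; rewrite -big_distrl/= mulrCA ler_wpM2l ?divr_ge0 ?ler0n//.
  exact: list_le.
rewrite -!big_distrr/= sum_sndmarg P1 mulr1 invfM.
by rewrite -mulrA (mulrC _ c^-1).
Qed.

End Binning.

(** * Memoryless pairs: product law, moments and typicality *)

Section IID.
Context {R : realType} {X Y : finType}.
Variable Q : X -> Y -> R.
Hypothesis Q_ge0 : forall x y, 0 <= Q x y.
Hypothesis Q_sum1 : \sum_x \sum_y Q x y = 1.

Lemma sum_tuple_cons (A : finType) n (F : n.+1.-tuple A -> R) :
  \sum_t F t = \sum_a \sum_(t : n.-tuple A) F [tuple of a :: t].
Proof.
rewrite pair_big/= (reindex (fun p : A * n.-tuple A => [tuple of p.1 :: p.2]))//.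
exists (fun t => (thead t, [tuple of behead t])) => [[a t] _|t _] /=.
  by congr pair; apply: val_inj.
by rewrite -tuple_eta.
Qed.

Lemma sum_tuple0 (A : finType) (F : 0.-tuple A -> R) : \sum_t F t = F [tuple].
Proof. by rewrite (big_pred1 [tuple])// => t; apply/esym/eqP/tuple0. Qed.

Lemma iidQ_ge0 n (xs : n.-tuple X) (ys : n.-tuple Y) : 0 <= iidQ Q xs ys.
Proof. exact: prodr_ge0. Qed.

Lemma iidQ_cons n x (xs : n.-tuple X) y (ys : n.-tuple Y) :
  iidQ Q [tuple of x :: xs] [tuple of y :: ys] = Q x y * iidQ Q xs ys.
Proof.
by rewrite /iidQ big_ord_recl !tnth0; congr (_ * _); apply: eq_bigr => i _; rewrite !tnthS.
Qed.

Lemma iid_expectation_cons n (F : n.+1.-tuple X -> n.+1.-tuple Y -> R) :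
  \sum_xs \sum_ys iidQ Q xs ys * F xs ys =
  \sum_x \sum_y Q x y * \sum_(xs : n.-tuple X) \sum_(ys : n.-tuple Y)
     iidQ Q xs ys * F [tuple of x :: xs] [tuple of y :: ys].
Proof.
rewrite sum_tuple_cons; apply: eq_bigr => x _.
under eq_bigr do rewrite sum_tuple_cons.
rewrite exchange_big; apply: eq_bigr => y _ /=.
rewrite big_distrr/=; apply: eq_bigr => xs _.
by rewrite big_distrr/=; apply: eq_bigr => ys _; rewrite iidQ_cons mulrA.
Qed.

Lemma iidQ_sum1 n : \sum_(xs : n.-tuple X) \sum_(ys : n.-tuple Y) iidQ Q xs ys = 1.
Proof.
elim: n => [|n IH].
  by rewrite !sum_tuple0 /iidQ big_ord0.
have := @iid_expectation_cons n (fun _ _ => 1).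
under eq_bigr do under eq_bigr do rewrite mulr1.
move=> ->; rewrite -[RHS]Q_sum1; apply: eq_bigr => x _; apply: eq_bigr => y _.
rewrite -[RHS]mulr1; congr (_ * _); rewrite -[RHS]IH.
by apply: eq_bigr => xs _; apply: eq_bigr => ys _; rewrite mulr1.
Qed.

Lemma sndmarg_iidQ n (ys : n.-tuple Y) :
  sndmarg (@iidQ R X Y Q n) ys = \prod_(i < n) sndmarg Q (tnth ys i).
Proof.
rewrite /sndmarg; elim: n ys => [|n IH] ys.
  by rewrite sum_tuple0 /iidQ !big_ord0.
case/tupleP: ys => y ys.
rewrite sum_tuple_cons big_ord_recl tnth0 big_distrl/=; apply: eq_bigr => x _.
under eq_bigr do rewrite iidQ_cons.
rewrite -big_distrr/= IH; congr (_ * _).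
by apply: eq_bigr => i _; rewrite tnthS.
Qed.

Section Moments.
Variable g : X -> Y -> R.
Hypothesis g_mean0 : \sum_x \sum_y Q x y * g x y = 0.

Definition tuple_sum n (xs : n.-tuple X) (ys : n.-tuple Y) : R :=
  \sum_(i < n) g (tnth xs i) (tnth ys i).

Lemma tuple_sum_cons n x (xs : n.-tuple X) y (ys : n.-tuple Y) :
  tuple_sum [tuple of x :: xs] [tuple of y :: ys] = g x y + tuple_sum xs ys.
Proof.
by rewrite /tuple_sum big_ord_recl !tnth0; congr (_ + _); apply: eq_bigr => i _; rewrite !tnthS.
Qed.

Lemma tuple_sum_mean n :
  \sum_(xs : n.-tuple X) \sum_(ys : n.-tuple Y) iidQ Q xs ys * tuple_sum xs ys = 0.
Proof.
elim: n => [|n IH].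
  by rewrite big1// => xs _; rewrite big1// => ys _; rewrite /tuple_sum big_ord0 mulr0.
rewrite iid_expectation_cons -[RHS]g_mean0.
apply: eq_bigr => x _; apply: eq_bigr => y _; congr (_ * _).
(* The factor 1 is expanded as the total mass and the added 0 as the induction hypothesis, so that
   both sides match term by term. *)
rewrite -[RHS]mulr1 -(iidQ_sum1 n) -[RHS]addr0 -[X in _ = _ + X]IH big_distrr -big_split/=.
apply: eq_bigr => xs _; rewrite big_distrr -big_split/=; apply: eq_bigr => ys _.
by rewrite tuple_sum_cons; ring.
Qed.

(** Variances of independent letters add: after splitting off the first letter, the cross term of
    the square vanishes because the remaining sum has mean zero. *)
Lemma tuple_sum_second_moment n :
  \sum_(xs : n.-tuple X) \sum_(ys : n.-tuple Y) iidQ Q xs ys * tuple_sum xs ys ^+ 2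
  = n%:R * \sum_x \sum_y Q x y * g x y ^+ 2.
Proof.
elim: n => [|n IH].
  by rewrite mul0r big1// => xs _; rewrite big1// => ys _; rewrite /tuple_sum big_ord0 expr0n mulr0.
rewrite iid_expectation_cons -natr1 mulrDl mul1r addrC -IH.
set m2 := (X in _ = _ + X).
rewrite -[m2]mul1r -[in RHS]Q_sum1 big_distrl -big_split/=; apply: eq_bigr => x _.
rewrite big_distrl -big_split/=; apply: eq_bigr => y _; rewrite -mulrDr; congr (_ * _).
have cross0 : 2 * g x y * (\sum_(xs : n.-tuple X) \sum_(ys : n.-tuple Y)
    iidQ Q xs ys * tuple_sum xs ys) = 0 by rewrite tuple_sum_mean mulr0.
rewrite -[g x y ^+ 2]mulr1 -(iidQ_sum1 n) -[RHS]addr0 -[X in _ = _ + X]cross0.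
rewrite !big_distrr/= -!big_split/=.
apply: eq_bigr => xs _; rewrite !big_distrr -!big_split/=; apply: eq_bigr => ys _.
by rewrite tuple_sum_cons; ring.
Qed.

Lemma tuple_sum_chebyshev n (d : R) : (0 < n)%N -> 0 < d ->
  prob (@iidQ R X Y Q n) (fun xs ys => n%:R * d <= `|tuple_sum xs ys|)
  <= (\sum_x \sum_y Q x y * g x y ^+ 2) / (n%:R * d ^+ 2).
Proof.
move=> n0 d0; have n0' : 0 < n%:R :> R by rewrite ltr0n.
have -> : (\sum_x \sum_y Q x y * g x y ^+ 2) / (n%:R * d ^+ 2) =
    (n%:R * d) ^- 2 * (n%:R * \sum_x \sum_y Q x y * g x y ^+ 2).
  by field; rewrite !gt_eqF.
rewrite -tuple_sum_second_moment big_distrr; apply: ler_sum => xs _ /=.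
rewrite big_distrr; apply: ler_sum => ys _ /=.
rewrite mulrCA ler_wpM2l ?iidQ_ge0// ler_pdivlMl ?exprn_gt0 ?mulr_gt0//.
case: (leP (_ * d)) => [le|_]; last by rewrite mulr0 sqr_ge0.
by rewrite mulr1 -[leRHS]real_normK ?num_real// ler_pXn2r// nnegrE ?mulr_ge0// ltW.
Qed.

End Moments.

Definition cond_info (x : X) (y : Y) : R := - ln (Q x y / sndmarg Q y).

Definition cond_ent_nat : R := \sum_x \sum_y Q x y * cond_info x y.

Definition cond_info_var : R :=
  \sum_x \sum_y Q x y * (cond_info x y - cond_ent_nat) ^+ 2.

Lemma cond_info_centered :
  \sum_x \sum_y Q x y * (cond_info x y - cond_ent_nat) = 0.
Proof.
under eq_bigr do under eq_bigr do rewrite mulrBr.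
under eq_bigr do rewrite sumrB -big_distrl/=.
by rewrite sumrB -big_distrl/= Q_sum1 mul1r subrr.
Qed.

Lemma le_sndmarg x y : Q x y <= sndmarg Q y.
Proof. by rewrite /sndmarg (bigD1 x)//= lerDl sumr_ge0. Qed.

(** Joint law and marginal both factor over the letters, so the conditional probability is the
    exponential of minus the summed information densities, written here as mean plus fluctuation. *)
Lemma iidQ_expR n (xs : n.-tuple X) (ys : n.-tuple Y) : 0 < iidQ Q xs ys ->
  iidQ Q xs ys = sndmarg (@iidQ R X Y Q n) ys *
    expR (- (n%:R * cond_ent_nat +
       tuple_sum (fun x y => cond_info x y - cond_ent_nat) xs ys)).
Proof.
move=> PQ.
have Qi i : 0 < Q (tnth xs i) (tnth ys i).
  rewrite lt_neqAle Q_ge0 andbT eq_sym; apply: contraTneq PQ => Qi0.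
  by rewrite /iidQ (bigD1 i)//= Qi0 mul0r ltxx.
have -> : n%:R * cond_ent_nat +
       tuple_sum (fun x y => cond_info x y - cond_ent_nat) xs ys
   = \sum_(i < n) cond_info (tnth xs i) (tnth ys i).
  by rewrite /tuple_sum sumrB sumr_const card_ord mulr_natl addrC subrK.
rewrite -sumrN expR_sum sndmarg_iidQ -big_split/=; apply: eq_bigr => i _.
have Yi : 0 < sndmarg Q (tnth ys i) by apply: lt_le_trans (Qi i) (le_sndmarg _ _).
by rewrite opprK lnK ?posrE ?divr_gt0// mulrCA divff ?mulr1// gt_eqF.
Qed.

(** Too large a conditional probability forces a fluctuation below [- n d]. This half of typicality
    serves the converse. *)
Lemma aep_upper n (d : R) : (0 < n)%N -> 0 < d ->
  prob (@iidQ R X Y Q n) (fun xs ys => sndmarg (@iidQ R X Y Q n) ys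
      * expR (- (n%:R * (cond_ent_nat - d))) < iidQ Q xs ys)
  <= cond_info_var / (n%:R * d ^+ 2).
Proof.
move=> n0 d0; apply: le_trans (tuple_sum_chebyshev cond_info_centered n0 d0).
apply: prob_le => [|xs ys PQ]; first exact: iidQ_ge0.
have Y0 : 0 < sndmarg (@iidQ R X Y Q n) ys.
  by apply: (lt_le_trans PQ); rewrite /sndmarg (bigD1 xs)//= lerDl sumr_ge0// => *; exact: iidQ_ge0.
rewrite (iidQ_expR PQ) ltr_pM2l// ltr_expR => A.
by rewrite ler_normr; apply/orP; right; lra.
Qed.

(** Too small a conditional probability forces a fluctuation above [n d]. This half serves the
    binning decoder. *)
Lemma aep_lower n (d : R) : (0 < n)%N -> 0 < d ->
  prob (@iidQ R X Y Q n) (fun xs ys => iidQ Q xs ys < sndmarg (@iidQ R X Y Q n) ys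
      * expR (- (n%:R * (cond_ent_nat + d))))
  <= cond_info_var / (n%:R * d ^+ 2).
Proof.
move=> n0 d0; apply: le_trans (tuple_sum_chebyshev cond_info_centered n0 d0).
apply: prob_le => [|xs ys PQ]; first exact: iidQ_ge0.
have Y0 : 0 < sndmarg (@iidQ R X Y Q n) ys.
  by apply: (lt_le_trans PQ); rewrite /sndmarg (bigD1 xs)//= lerDl sumr_ge0// => *; exact: iidQ_ge0.
rewrite [X in X < _](iidQ_expR PQ) ltr_pM2l// ltr_expR => A.
by rewrite ler_normr; apply/orP; left; lra.
Qed.

End IID.

(** * Conditional entropy: log-sum inequality and erasure channel *)

Section CondEnt.
Context {R : realType}.

Lemma ln2_gt0 : 0 < ln 2 :> R.
Proof. by rewrite ln_gt0// ltr1n. Qed.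

Lemma ln2_neq0 : ln 2 != 0 :> R.
Proof. by rewrite gt_eqF ?ln2_gt0. Qed.

Lemma entterm_ge0 (p c : R) : 0 <= p -> p <= c -> 0 <= entterm p c.
Proof.
rewrite /entterm le_eqVlt eq_sym; case: eqP => //= _ p0 pc.
have c0 : 0 < c by exact: lt_le_trans pc.
rewrite oppr_ge0 mulr_ge0_le0 ?(ltW p0)// /log2 pmulr_lle0 ?invr_gt0 ?ln2_gt0//.
by rewrite ln_le0// ler_pdivrMr// mul1r.
Qed.

Lemma entterm_scale (l p c : R) : entterm (l * p) (l * c) = l * entterm p c.
Proof.
rewrite /entterm mulf_eq0; have [->|l0] /= := eqVneq l 0; first by rewrite mul0r.
case: eqP => [_|_]; first by rewrite mulr0.
by rewrite -mulf_div divff// mul1r mulrN -[in LHS]mulrA.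
Qed.

Lemma entterm_diag (p : R) : entterm p p = 0.
Proof.
rewrite /entterm; have [//|p0] := eqVneq p 0.
by rewrite divff// /log2 ln1 mul0r mulr0 oppr0.
Qed.

(* Tangent line of the logarithm at the ratio [P / C]. *)
Lemma entterm_le_tangent (p c P C : R) : 0 <= p -> p <= c -> 0 < P -> 0 < C ->
  entterm p c <= - (p * log2 (P / C)) + (P * c / C - p) / ln 2.
Proof.
move=> p0 pc P0 C0; rewrite /entterm; case: eqP => [->|/eqP pN0].
  rewrite mul0r oppr0 add0r addr0; have c0 := le_trans p0 pc.
  by do !apply: mulr_ge0 => //; rewrite ?invr_ge0 ltW ?ln2_gt0.
have {}p0 : 0 < p by rewrite lt_neqAle eq_sym pN0.
have c0 : 0 < c by exact: lt_le_trans pc.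
have t0 : 0 < P * c / (C * p) by rewrite divr_gt0 ?mulr_gt0.
have lnt : ln (P / C) - ln (p / c) <= P * c / (C * p) - 1.
  rewrite -ln_div ?posrE ?divr_gt0//.
  have -> : P / C / (p / c) = 1 + (P * c / (C * p) - 1) by field; rewrite !gt_eqF.
  by apply: le_ln1Dx; rewrite ltrBDl subrr.
rewrite -subr_ge0 /log2.
have -> : - (p * (ln (P / C) / ln 2)) + (P * c / C - p) / ln 2 - - (p * (ln (p / c) / ln 2))
  = p / ln 2 * (P * c / (C * p) - 1 - (ln (P / C) - ln (p / c))).
  by field; rewrite !gt_eqF// ln2_gt0.
by rewrite mulr_ge0 ?subr_ge0// divr_ge0 ?ltW ?ln2_gt0.
Qed.

(** The log-sum inequality. All tangents are taken at the ratio of the two totals, so their linear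
    corrections sum to zero. *)
Lemma sum_entterm_le (A : finType) (p c : A -> R) :
  (forall a, 0 <= p a) -> (forall a, p a <= c a) ->
  \sum_a entterm (p a) (c a) <= entterm (\sum_a p a) (\sum_a c a).
Proof.
move=> p0 pc; have c0 a : 0 <= c a by apply: le_trans (pc a).
have [P0|P0] := eqVneq (\sum_a p a) 0.
  rewrite P0 /entterm eqxx big1// => a _.
  have /psumr_eq0P/(_ P0) -> // := (fun a (_ : true) => p0 a).
  by rewrite eqxx.
have Pgt0 : 0 < \sum_a p a by rewrite lt_neqAle eq_sym P0 sumr_ge0.
have Cgt0 : 0 < \sum_a c a by apply: lt_le_trans Pgt0 _; apply: ler_sum.
apply: le_trans (ler_sum _ (fun a _ => entterm_le_tangent (p0 a) (pc a) Pgt0 Cgt0)) _.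
rewrite big_split/= sumrN -!big_distrl/= sumrB -big_distrl/= -big_distrr/=.
by rewrite -mulrA divff ?gt_eqF// mulr1 subrr mul0r addr0 /entterm (negPf P0).
Qed.

Section Region.
Context {X Y : finType}.

(** Entropy in bits of the first argument given the second, while [cond_ent_nat] is in nats; the
    other direction is obtained by transposing [Q]. *)
Definition cond_ent (Q : X -> Y -> R) : R :=
  \sum_x \sum_y entterm (Q x y) (sndmarg Q y).

Lemma cond_ent_natE (Q : X -> Y -> R) : cond_ent_nat Q = cond_ent Q * ln 2.
Proof.
rewrite big_distrl; apply: eq_bigr => x _; rewrite big_distrl; apply: eq_bigr => y _ /=.
rewrite /cond_info /entterm /log2; case: eqP => [->|_]; first by rewrite !mul0r.
by rewrite mulrN mulNr -mulrA divfK// ln2_neq0.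
Qed.

Lemma cond_ent_ge0 (Q : X -> Y -> R) : (forall x y, 0 <= Q x y) -> 0 <= cond_ent Q.
Proof.
move=> Q0; apply: sumr_ge0 => x _; apply: sumr_ge0 => y _.
by rewrite entterm_ge0// le_sndmarg.
Qed.

Lemma eq_cond_ent (Q Q' : X -> Y -> R) : Q =2 Q' -> cond_ent Q = cond_ent Q'.
Proof.
move=> QQ'; apply: eq_bigr => x _; apply: eq_bigr => y _; rewrite QQ'; congr entterm.
by apply: eq_bigr => x' _; rewrite QQ'.
Qed.

(** Conditioning on [a] reduces entropy, by the log-sum inequality at each pair [x], [y]. The slices
    [q a] are not normalized, so the weights of [a] are already included. *)
Lemma sum_cond_ent_le (A : finType) (q : A -> X -> Y -> R) (Q : X -> Y -> R) :
  (forall a x y, 0 <= q a x y) -> (forall x y, \sum_a q a x y = Q x y) ->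
  \sum_a cond_ent (q a) <= cond_ent Q.
Proof.
move=> q0 qQ; rewrite /cond_ent exchange_big; apply: ler_sum => x _ /=.
rewrite exchange_big; apply: ler_sum => y _ /=.
rewrite -qQ (_ : sndmarg Q y = \sum_a sndmarg (q a) y).
  by apply: sum_entterm_le => a //; exact: le_sndmarg.
by rewrite exchange_big; apply: eq_bigr => x' _.
Qed.

End Region.

Lemma sum_enum_val (T : finType) (F : T -> R) :
  \sum_(i < #|T|) F (enum_val i) = \sum_t F t.
Proof. by rewrite [RHS](reindex _ (onW_bij _ (enum_val_bij T))). Qed.

(** Transition probability from [x] to [o] of the erasure channel; [None] is the erasure symbol. *)
Definition erasure (X : finType) (l : R) (o : option X) (x : X) : R :=
  if o is Some x' then (1 - l) * (x' == x)%:R else l.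

Lemma sum_option (X : finType) (F : option X -> R) :
  \sum_o F o = F None + \sum_x F (Some x).
Proof.
by rewrite ![index_enum _]unlock [@Finite.enum in LHS]unlock/= big_cons big_map.
Qed.

Lemma sum_erasure (X : finType) (l : R) (x : X) : \sum_o erasure l o x = 1.
Proof.
rewrite sum_option /= -big_distrr/= (bigD1 x)//= eqxx big1 => [|x' /negPf -> //].
by rewrite addr0 mulr1 addrC subrK.
Qed.

(** A surviving symbol determines [x] and contributes no entropy; the erased slice is [Q] scaled by
    [l]. *)
Lemma cond_ent_erasure (X Y : finType) (l : R) (Q : X -> Y -> R) :
  \sum_o cond_ent (fun x y => erasure l o x * Q x y) = l * cond_ent Q.
Proof.
rewrite sum_option big1 ?addr0 => [|x' _].
  rewrite /cond_ent big_distrr; apply: eq_bigr => x _.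
  rewrite big_distrr; apply: eq_bigr => y _ /=.
  by rewrite -entterm_scale /sndmarg big_distrr.
rewrite /cond_ent big1// => x _; rewrite big1// => y _ /=.
have [->|xx'] := eqVneq x' x; last by rewrite mulr0 mul0r /entterm eqxx.
rewrite /sndmarg (bigD1 x)//= eqxx big1 ?addr0 ?entterm_diag//.
by move=> i /negPf; rewrite eq_sym => ->; rewrite mulr0 mul0r.
Qed.

End CondEnt.

(** * The single-letter union is a closed polyhedron *)

Section RateRegion.
Context {R : realType} {X Y : finType}.
Variable Q : X -> Y -> R.
Hypothesis Q_ge0 : forall x y, 0 <= Q x y.
Hypothesis Q_sum1 : \sum_x \sum_y Q x y = 1.

Definition rate_region : set (R * R * R) :=
  [set r | [/\ 0 <= r.1.1, 0 <= r.1.2, 0 <= r.2, cond_ent Q <= r.1.1 + r.1.2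
             & cond_ent (fun y x => Q x y) <= r.1.1 + r.2]].

Lemma closed_rate_region : closed rate_region.
Proof.
have cl (f : R * R * R -> R) (a : R) : continuous f -> closed [set r | a <= f r].
  move=> cf; apply: (preimage_closed (D := [set x : R | a <= x]%classic)) => [r _|].
    exact: cf.
  exact: closed_ge.
have c00 : continuous (fun r : R * R * R => r.1.1).
  by move=> r; apply: (@continuous_comp _ _ _ fst fst); apply: cvg_fst.
have c01 : continuous (fun r : R * R * R => r.1.2).
  by move=> r; apply: (@continuous_comp _ _ _ fst snd); [apply: cvg_fst|apply: cvg_snd].
have c1 : continuous (fun r : R * R * R => r.2) by move=> r; apply: cvg_snd.
rewrite (_ : rate_region = [set r | 0 <= r.1.1] `&` [set r | 0 <= r.1.2] `&`
   [set r | 0 <= r.2] `&` [set r | cond_ent Q <= r.1.1 + r.1.2] `&`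
   [set r | cond_ent (fun y x => Q x y) <= r.1.1 + r.2])%classic; last first.
  by apply/seteqP; split => r [] // [[[]]].
do 4?apply: closedI; apply: cl; [exact: c00|exact: c01|exact: c1| |] => r; apply: cvgD.
all: by [exact: c00|exact: c01|exact: c1].
Qed.

Section Auxiliary.
Context {A B : finType}.
Variable p : A -> B -> X -> Y -> R.
Hypothesis pQ : Pstarstar Q p.

Lemma H_X_AY_ge0 : 0 <= H_X_AY p.
Proof. by apply: sumr_ge0 => a _; apply: cond_ent_ge0 => x y; apply: sumr_ge0 => b _; case: pQ. Qed.

Lemma H_X_YE : H_X_Y p = cond_ent Q.
Proof. by apply: (eq_cond_ent (Q := pXY p)) => x y; case: pQ => _ <-. Qed.

Lemma H_Y_XE : H_Y_X p = cond_ent (fun y x => Q x y).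
Proof.
rewrite /H_Y_X exchange_big; apply: (eq_cond_ent (Q := fun y x => pXY p x y)) => y x.
by case: pQ => _ <-.
Qed.

Lemma H_Y_BXE : H_Y_BX p = \sum_b cond_ent (fun y x => pBXY p b x y).
Proof. by apply: eq_bigr => b _; rewrite exchange_big. Qed.

Lemma I_XA_Y_ge0 : 0 <= I_XA_Y p.
Proof.
case: (pQ) => p0 pE.
rewrite subr_ge0 H_X_YE; apply: sum_cond_ent_le => // a x y; exact: sumr_ge0.
Qed.

Lemma I_YB_X_ge0 : 0 <= I_YB_X p.
Proof.
case: (pQ) => p0 pE.
rewrite subr_ge0 H_Y_XE H_Y_BXE; apply: sum_cond_ent_le => [b y x|y x]; first exact: sumr_ge0.
by rewrite -pE exchange_big.
Qed.

End Auxiliary.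

(** The bounds on the two rates of a receiver add up to its conditional entropy, since the mutual
    information is a difference of entropies. *)
Lemma union_region_sub : (union_region Q `<=` rate_region)%classic.
Proof.
move=> r [a [b [_ [_ [p [pQ [+ [R1 R2]]]]]]]]; rewrite ge_max => /andP[R0 R0'].
split.
- exact: le_trans (H_X_AY_ge0 pQ) R0.
- exact: le_trans (I_XA_Y_ge0 pQ) R1.
- exact: le_trans (I_YB_X_ge0 pQ) R2.
- by have := lerD R0 R1; rewrite addrC subrK H_X_YE.
- by have := lerD R0' R2; rewrite addrC subrK H_Y_XE.
Qed.

(** Provides the erasure probability: 1 if [r0] alone covers [H], and [r0 / H] otherwise. *)
Lemma exists_split (H r0 r1 : R) : 0 <= H -> 0 <= r0 -> 0 <= r1 -> H <= r0 + r1 ->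
  exists l, [/\ 0 <= l, l <= 1, l * H <= r0 & H - l * H <= r1].
Proof.
move=> H0 r00 r10 Hr; have [Hr0|r0H] := leP H r0.
  by exists 1; rewrite !mul1r subrr.
have Hgt0 : 0 < H by exact: le_lt_trans r0H.
exists (r0 / H); rewrite divfK ?gt_eqF//; split=> //; first exact: divr_ge0.
  by rewrite ler_pdivrMr// mul1r ltW.
by rewrite lerBlDl.
Qed.

Lemma support_inhabited : exists x y, 0 < Q x y.
Proof.
apply: contrapT => noxy; have := oner_eq0 R; rewrite -Q_sum1 big1 ?eqxx// => x _.
rewrite big1// => y _; apply/eqP; rewrite eq_le Q_ge0 andbT leNgt.
by apply/negP => xy; apply: noxy; exists x, y.
Qed.

Lemma rate_region_sub : (rate_region `<=` union_region Q)%classic.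
Proof.
move=> r [r00 r10 r20 rX rY]; have [x0 [y0 _]] := support_inhabited.
have [l [l0 l1 lR0 lR1]] := exists_split (cond_ent_ge0 Q_ge0) r00 r10 rX.
have [m [m0 m1 mR0 mR1]] :=
  exists_split (cond_ent_ge0 (fun y x => Q_ge0 x y)) r00 r20 rY.
have er0 (Z : finType) k (o : option Z) z : 0 <= k -> k <= 1 -> 0 <= erasure k o z :> R.
  by move=> k0 k1; case: o => //= z'; rewrite mulr_ge0// subr_ge0.
(* Given [x] and [y], the two erasures are independent, so summing out either auxiliary variable
   leaves the other channel intact. *)
pose p (a : 'I_#|{: option X}|) (b : 'I_#|{: option Y}|) x y : R :=
  erasure l (enum_val a) x * Q x y * erasure m (enum_val b) y.
have pA a x y : pAXY p a x y = erasure l (enum_val a) x * Q x y.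
  by rewrite /pAXY -big_distrr/= (sum_enum_val (fun o => erasure m o y)) sum_erasure mulr1.
have pB b x y : pBXY p b x y = erasure m (enum_val b) y * Q x y.
  rewrite /pBXY -!big_distrl/= (sum_enum_val (fun o => erasure l o x)) sum_erasure mul1r.
  by rewrite mulrC.
have pQ : Pstarstar Q p.
  split=> [a b x y|x y]; first by rewrite !mulr_ge0 ?er0.
  rewrite (eq_bigr _ (fun a _ => pA a x y)).
  by rewrite -big_distrl/= (sum_enum_val (fun o => erasure l o x)) sum_erasure mul1r.
have HX : H_X_AY p = l * cond_ent Q.
  rewrite -cond_ent_erasure -sum_enum_val; apply: eq_bigr => a _.
  by apply: (eq_cond_ent (Q := pAXY p a)) => x y; exact: pA.
have HY : H_Y_BX p = m * cond_ent (fun y x => Q x y).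
  rewrite -cond_ent_erasure -sum_enum_val H_Y_BXE; apply: eq_bigr => b _.
  by apply: eq_cond_ent => y x; exact: pB.
exists #|{: option X}|, #|{: option Y}|; split; last split.
(* The alphabet has [#|X| + 1] letters, within the bound because [Y] is inhabited. *)
- by rewrite card_option -addn1 leq_add2r leq_pmulr//; apply/card_gt0P; exists y0.
- by rewrite card_option -addn1 leq_add2r leq_pmull//; apply/card_gt0P; exists x0.
exists p; split=> //; split; first by rewrite ge_max HX HY lR0.
by rewrite /I_XA_Y /I_YB_X (H_X_YE pQ) (H_Y_XE pQ) HX HY.
Qed.

Lemma closure_union_region : closure (union_region Q) = rate_region.
Proof.
have -> : union_region Q = rate_region.
  by apply/seteqP; split; [exact: union_region_sub|exact: rate_region_sub].
exact/esym/closure_id/closed_rate_region.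
Qed.

End RateRegion.

(** * Rates, message counts and elementary asymptotics *)

Section Rates.
Context {R : realType}.

Lemma log2_nat_ge0 (k : nat) : 0 <= log2 k%:R :> R.
Proof.
case: k => [|k]; first by rewrite /log2 ln0// mul0r.
by rewrite divr_ge0 ?(ltW ln2_gt0)// ln_ge0// ler1n.
Qed.

Lemma rate_le (n k : nat) (r : R) : (0 < n)%N -> (0 < k)%N ->
  (n%:R^-1 * log2 k%:R <= r) = (k%:R <= expR (n%:R * r * ln 2)).
Proof.
move=> n0 k0; rewrite ler_pdivrMl ?ltr0n// /log2 ler_pdivrMr ?ln2_gt0//.
by rewrite -ler_expR lnK// posrE ltr0n.
Qed.

Lemma card_le_rate (n k : nat) (r : R) : (0 < n)%N ->
  n%:R^-1 * log2 k%:R <= r -> k%:R <= expR (n%:R * r * ln 2).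
Proof. by move=> n0; case: k => [|k]; [rewrite expR_ge0|rewrite rate_le]. Qed.

Lemma eventually_div_le (C eps : R) : 0 < eps ->
  exists N, forall n, (N <= n)%N -> (0 < n)%N /\ C / n%:R <= eps.
Proof.
move=> e0; exists (Num.truncn (C / eps)).+1 => n Nn; have n0 : (0 < n)%N by exact: leq_trans Nn.
split=> //; rewrite ler_pdivrMr ?ltr0n// mulrC -ler_pdivrMr//.
by apply: ltW; apply: lt_le_trans (truncnS_gt _) _; rewrite ler_nat.
Qed.

(** This crude bound gives exponential terms the same form, a constant over [n], as the Chebyshev
    terms. *)
Lemma expRN_le (x : R) : 0 < x -> expR (- x) <= x^-1.
Proof.
move=> x0; rewrite expRN lef_pV2 ?posrE ?expR_gt0//.
by apply: le_trans (expR_ge1Dx x); rewrite lerDr.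
Qed.

Lemma exists_le_average (I : finType) (F : I -> R) (B : R) : (0 < #|I|)%N ->
  \sum_i F i <= #|I|%:R * B -> exists i, F i <= B.
Proof.
move=> /card_gt0P[i0 _] FB; apply: contrapT => noF.
have BF i : B < F i by rewrite ltNge; apply/negP => ?; apply: noF; exists i.
move: FB; rewrite mulr_natl -sumr_const leNgt => /negP; apply.
by apply: ltr_sum => //; apply/hasP; exists i0; rewrite ?mem_index_enum.
Qed.

End Rates.

(** * Converse for a single receiver *)

Section Converse.
Context {R : realType} {X Y : finType}.
Variable Q : X -> Y -> R.
Hypothesis Q_ge0 : forall x y, 0 <= Q x y.
Hypothesis Q_sum1 : \sum_x \sum_y Q x y = 1.

(** The problem of one receiver in isolation; it is applied to [Q] and to its transpose. *)
Definition side_info_achievable (r0 r1 : R) : Prop :=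
  forall eps : R, 0 < eps -> exists N : nat, forall n : nat, (N <= n)%N ->
    exists (k0 k1 : nat) (f : n.-tuple X -> n.-tuple Y -> 'I_k0 * 'I_k1)
      (d : 'I_k0 -> 'I_k1 -> n.-tuple Y -> n.-tuple X),
      [/\ prob (@iidQ R X Y Q n) (fun xs ys => d (f xs ys).1 (f xs ys).2 ys != xs) <= eps,
          n%:R^-1 * log2 k0%:R <= r0 + eps & n%:R^-1 * log2 k1%:R <= r1 + eps].

Lemma side_info_rate_ge0 r0 r1 : side_info_achievable r0 r1 -> 0 <= r0 /\ 0 <= r1.
Proof.
move=> ach; split; apply/ler_addgt0Pr => eps e0; have [N /(_ N (leqnn _))] := ach eps e0.
  move=> [k0 [k1 [f [d [_ + _]]]]]; apply: le_trans.
  by rewrite mulr_ge0 ?invr_ge0 ?log2_nat_ge0.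
move=> [k0 [k1 [f [d [_ _]]]]]; apply: le_trans.
by rewrite mulr_ge0 ?invr_ge0 ?log2_nat_ge0.
Qed.

Lemma side_info_converse r0 r1 : side_info_achievable r0 r1 -> cond_ent Q <= r0 + r1.
Proof.
move=> ach; rewrite leNgt; apply/negP => rH.
(* A quarter of the gap for each of the two rate slacks, one for the typicality slack [d], and one
   left as the decay exponent. *)
pose eta := (cond_ent Q - (r0 + r1)) / 4.
have eta0 : 0 < eta by rewrite divr_gt0// subr_gt0.
pose eps := Num.min eta (1 / 4); pose d := eta * ln 2.
have eps0 : 0 < eps by rewrite lt_min eta0 divr_gt0.
have eps_eta : eps <= eta by rewrite ge_min lexx.
have eps4 : eps <= 1 / 4 by rewrite ge_min lexx orbT.
have d0 : 0 < d by rewrite mulr_gt0 ?ln2_gt0.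
have [N1 ach1] := ach eps eps0.
have [N2 small] := eventually_div_le (cond_info_var Q / d ^+ 2 + d^-1) (ltac:(lra) : 0 < 1 / 2).
pose n := maxn N1 N2; have [n0 Cn] := small n (leq_maxr _ _).
have [k0 [k1 [f [dec [err rate0 rate1]]]]] := ach1 n (leq_maxl _ _).
have n0' : 0 < n%:R :> R by rewrite ltr0n.
pose c := expR (- (n%:R * (cond_ent_nat Q - d))).
have typ := aep_upper Q_ge0 Q_sum1 n0 d0.
have := one_shot_converse (iidQ_ge0 Q_ge0 (n := n)) f dec (expR_ge0 _ : 0 <= c)
  (iidQ_sum1 Q_sum1 n).
have k0k1 : (k0 * k1)%:R * c <= (n%:R * d)^-1.
  apply: le_trans (expRN_le _); last by rewrite mulr_gt0.
  apply: (@le_trans _ _ (expR (n%:R * (r0 + eps) * ln 2) * expR (n%:R * (r1 + eps) * ln 2) * c)).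
    by rewrite natrM ler_wpM2r ?expR_ge0// ler_pM// card_le_rate.
  rewrite -!expRD ler_expR cond_ent_natE -subr_ge0.
  have -> : cond_ent Q = r0 + r1 + 4 * eta by rewrite /eta; field.
  rewrite [leRHS](_ : _ = n%:R * ln 2 * (2 * (eta - eps))); last by rewrite /d; ring.
  by rewrite !mulr_ge0 ?subr_ge0// ltW ?ln2_gt0.
have Cn' : cond_info_var Q / (n%:R * d ^+ 2) + (n%:R * d)^-1 <= 1 / 2.
  by apply: le_trans Cn; rewrite le_eqVlt; apply/orP; left; apply/eqP; field; rewrite !gt_eqF.
(* The error is at most 1/4 and the two other terms together at most 1/2, which cannot add up to
   1. *)
rewrite -/c in typ; lra.
Qed.

End Converse.

(** * Binning error for memoryless sources *)

Section Achievability.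
Context {R : realType} {X Y : finType}.
Variable Q : X -> Y -> R.
Hypothesis Q_ge0 : forall x y, 0 <= Q x y.
Hypothesis Q_sum1 : \sum_x \sum_y Q x y = 1.

(** With threshold [exp (- n (H + d))] and at least [exp (n (H + 2 d)) / 4] bins, the collision term
    is at most [4 exp (- n d)]. The factor 4 absorbs the rounding of two message counts. *)
Lemma iid_binning_error (W M C : finType) n (h : M -> C) (k : nat)
    (g : n.-tuple X -> n.-tuple Y -> W) (xs0 : n.-tuple X) (d : R) :
  (forall c, #|[pred m | h m == c]| = k) -> (0 < #|C|)%N ->
  (forall ys, injective (g^~ ys)) -> (0 < n)%N -> 0 < d ->
  expR (n%:R * (cond_ent_nat Q + 2 * d)) <= 4 * #|C|%:R ->
  \sum_(E : {ffun W -> M}) prob (@iidQ R X Y Q n) (fun xs ys =>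
     bin_decode (@iidQ R X Y Q n) h g xs0 (expR (- (n%:R * (cond_ent_nat Q + d))))
       E (h (E (g xs ys))) ys != xs)
  <= #|{ffun W -> M}|%:R * ((cond_info_var Q / d ^+ 2 + 4 / d) / n%:R).
Proof.
move=> h_bal C0 g_inj n0 d0 C_ge; have n0' : 0 < n%:R :> R by rewrite ltr0n.
set c := expR _; have C0' : 0 < #|C|%:R :> R by rewrite ltr0n.
apply: (le_trans (sum_bin_decode_error (iidQ_ge0 Q_ge0 (n := n)) h_bal xs0 g_inj
  (expR_gt0 _ : 0 < c) C0 (iidQ_sum1 Q_sum1 n))).
rewrite ler_wpM2l//.
have -> : (cond_info_var Q / d ^+ 2 + 4 / d) / n%:R
    = cond_info_var Q / (n%:R * d ^+ 2) + 4 * (n%:R * d)^-1 by field; rewrite !gt_eqF.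
apply: lerD; first exact: aep_lower.
apply: (@le_trans _ _ (4 * expR (- (n%:R * d)))); last first.
  by rewrite ler_wpM2l// expRN_le// mulr_gt0.
rewrite -[leLHS]mul1r ler_pdivrMr ?mulr_gt0 ?expR_gt0//.
have -> : 4 * expR (- (n%:R * d)) * (c * #|C|%:R) =
   expR (- (n%:R * (cond_ent_nat Q + 2 * d))) * (4 * #|C|%:R).
  rewrite (_ : - (n%:R * (cond_ent_nat Q + 2 * d))
    = - (n%:R * d) + - (n%:R * (cond_ent_nat Q + d))); last by ring.
  by rewrite expRD -/c; ring.
by rewrite expRN ler_pdivlMl ?expR_gt0// mulr1.
Qed.

End Achievability.

(** * Both receivers together: the operational region *)

Section Coding.
Context {R : realType} {X Y : finType}.
Variable Q : X -> Y -> R.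
Hypothesis Q_ge0 : forall x y, 0 <= Q x y.
Hypothesis Q_sum1 : \sum_x \sum_y Q x y = 1.

Lemma sum1_swap : \sum_y \sum_x Q x y = 1.
Proof. by rewrite exchange_big. Qed.

Lemma err_yE n k0 k1 k2 (e : n.-tuple X -> n.-tuple Y -> 'I_k0 * 'I_k1 * 'I_k2) dy :
  err_y Q e dy = prob (@iidQ R Y X (fun y x => Q x y) n)
     (fun ys xs => dy (e xs ys).1.1 (e xs ys).2 xs != ys).
Proof. exact: exchange_big. Qed.

Lemma achievable_sub : (achievable_region Q `<=` rate_region Q)%classic.
Proof.
move=> r ach.
have achX : side_info_achievable Q r.1.1 r.1.2.
  move=> eps /ach[N codes]; exists N => n /codes[k0 [k1 [k2 [e [dx [dy]]]]]].
  rewrite ge_max => -[/andP[ex _] [h0 [h1 _]]].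
  by exists k0, k1, (fun xs ys => (e xs ys).1), dx; split.
have achY : side_info_achievable (fun y x => Q x y) r.1.1 r.2.
  move=> eps /ach[N codes]; exists N => n /codes[k0 [k1 [k2 [e [dx [dy]]]]]].
  rewrite ge_max err_yE => -[/andP[_ ey] [h0 [_ h2]]].
  by exists k0, k2, (fun ys xs => ((e xs ys).1.1, (e xs ys).2)), dy; split.
have [r00 r10] := side_info_rate_ge0 achX; have [_ r20] := side_info_rate_ge0 achY.
split=> //; first exact: side_info_converse achX.
by apply: side_info_converse achY => //; exact: sum1_swap.
Qed.

(** Balance of the projection to the messages seen by the first receiver, as the collision count
    requires. *)
Lemma card_fst_fst_fiber (A B C : finType) (c : A * B) :
  #|[pred m : A * B * C | (m.1.1, m.1.2) == c]| = #|C|.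
Proof.
case: c => a b; rewrite -(card_codom (f := fun c => (a, b, c))) => [|c c' []//].
apply: eq_card => -[[a' b'] c]; rewrite !inE/=.
by apply/eqP/codomP => [[-> ->]|[c' [-> -> _]]//]; exists c.
Qed.

Lemma card_fst_snd_fiber (A B C : finType) (c : A * C) :
  #|[pred m : A * B * C | (m.1.1, m.2) == c]| = #|B|.
Proof.
case: c => a c; rewrite -(card_codom (f := fun b => (a, b, c))) => [|b b' []//].
apply: eq_card => -[[a' b] c']; rewrite !inE/=.
by apply/eqP/codomP => [[-> ->]|[b' [-> _ ->]]//]; exists b.
Qed.

(** The truncation is at least 1, so rounding down loses at most a factor 2. *)
Lemma truncn_expR_ge (x : R) : 0 <= x -> expR x <= 2 * (Num.truncn (expR x))%:R.
Proof.
move=> x0; have := truncnS_gt (expR x); rewrite -natr1 => lt.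
have : 1 <= (Num.truncn (expR x))%:R :> R.
  rewrite ler1n; apply: contraTT lt; rewrite lt0n negbK => /eqP ->.
  by rewrite add0r -leNgt -expR0 ler_expR.
lra.
Qed.

(** One random codebook maps each pair of words to a triple of messages, and each receiver decodes
    from its projection of that triple and its own word. *)
Lemma sub_achievable : (rate_region Q `<=` achievable_region Q)%classic.
Proof.
move=> r [r00 r10 r20 rX rY] eps eps0.
(* This is [eps] in nats: the slack of the two rates gives the surplus [2 * d] over the entropy. *)
pose d := eps * ln 2; have d0 : 0 < d by rewrite mulr_gt0 ?ln2_gt0.
pose Q' y x := Q x y.
pose KX := cond_info_var Q / d ^+ 2 + 4 / d.
pose KY := cond_info_var Q' / d ^+ 2 + 4 / d.
have [N small] := eventually_div_le (KX + KY) eps0.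
exists N => n /small[n0 Kn].
have [x0 [y0 _]] := support_inhabited Q_ge0 Q_sum1.
pose xs0 := [tuple of nseq n x0]; pose ys0 := [tuple of nseq n y0].
(* Rounding down keeps the rate at most [a + eps]. *)
pose k (a : R) := Num.truncn (expR (n%:R * (a + eps) * ln 2)).
have k_ge a : 0 <= a -> expR (n%:R * (a + eps) * ln 2) <= 2 * (k a)%:R.
  by move=> a0; apply: truncn_expR_ge; rewrite !mulr_ge0 ?addr_ge0 ?(ltW eps0) ?(ltW ln2_gt0).
have k_gt0 a : 0 <= a -> (0 < k a)%N.
  move=> /k_ge; apply: contraTT; rewrite lt0n negbK => /eqP ->.
  by rewrite mulr0 -ltNge expR_gt0.
have k_rate a : 0 <= a -> n%:R^-1 * log2 (k a)%:R <= a + eps.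
  by move=> a0; rewrite rate_le ?k_gt0// truncn_le expR_ge0.
have size_ge (H a b : R) : 0 <= a -> 0 <= b -> H <= a + b ->
    expR (n%:R * (H * ln 2 + 2 * d)) <= 4 * #|{: 'I_(k a) * 'I_(k b)}|%:R.
  move=> a0 b0 Hab; rewrite card_prod !card_ord natrM.
  rewrite [leRHS](_ : _ = 2 * (k a)%:R * (2 * (k b)%:R)); last by ring.
  apply: le_trans (ler_pM (expR_ge0 _) (expR_ge0 _) (k_ge a a0) (k_ge b b0)).
  rewrite -expRD ler_expR.
  rewrite [leRHS](_ : _ = n%:R * ((a + b) * ln 2 + 2 * d)); last by rewrite /d; ring.
  by rewrite ler_wpM2l// lerD2r ler_wpM2r// ltW ?ln2_gt0.
have C_gt0 a b : 0 <= a -> 0 <= b -> (0 < #|{: 'I_(k a) * 'I_(k b)}|)%N.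
  by move=> a0 b0; rewrite card_prod !card_ord muln_gt0 !k_gt0.
pose M := ('I_(k r.1.1) * 'I_(k r.1.2) * 'I_(k r.2))%type.
pose W := (n.-tuple X * n.-tuple Y)%type.
pose hx (m : M) := (m.1.1, m.1.2); pose hy (m : M) := (m.1.1, m.2).
have balx c : #|[pred m | hx m == c]| = k r.2 by rewrite card_fst_fst_fiber card_ord.
have baly c : #|[pred m | hy m == c]| = k r.1.2 by rewrite card_fst_snd_fiber card_ord.
pose gx (xs : n.-tuple X) (ys : n.-tuple Y) : W := (xs, ys).
pose gy (ys : n.-tuple Y) (xs : n.-tuple X) : W := (xs, ys).
have injx ys : injective (gx^~ ys) by move=> xs xs' [].
have injy xs : injective (gy^~ xs) by move=> ys ys' [].
have sizex := size_ge _ _ _ r00 r10 rX; rewrite -cond_ent_natE in sizex.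
have sizey := size_ge _ _ _ r00 r20 rY; rewrite -cond_ent_natE in sizey.
have avgx := iid_binning_error Q_ge0 Q_sum1 xs0 balx (C_gt0 _ _ r00 r10) injx n0 d0 sizex.
have avgy := iid_binning_error (fun y x => Q_ge0 x y) sum1_swap ys0 baly
  (C_gt0 _ _ r00 r20) injy n0 d0 sizey.
(* Averaging the sum of the two errors yields a single codebook that is good for both receivers. *)
have := lerD avgx avgy; rewrite -big_split -mulrDr => /exists_le_average [|E /= errE].
  by rewrite card_ffun expn_gt0 !card_prod !card_ord !muln_gt0 !k_gt0.
exists (k r.1.1), (k r.1.2), (k r.2), (fun xs ys => E (xs, ys)).
exists (fun m0 m1 => bin_decode (@iidQ R X Y Q n) hx gx xs0
  (expR (- (n%:R * (cond_ent_nat Q + d)))) E (m0, m1)).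
exists (fun m0 m2 => bin_decode (@iidQ R Y X Q' n) hy gy ys0
  (expR (- (n%:R * (cond_ent_nat Q' + d)))) E (m0, m2)).
split; last by rewrite !k_rate.
have P0 (X' Y' : finType) (P : X' -> Y' -> R) A : (forall x y, 0 <= P x y) -> 0 <= prob P A.
  by move=> P0; apply: sumr_ge0 => x _; apply: sumr_ge0 => y _; rewrite mulr_ge0.
rewrite ge_max; move: errE Kn; rewrite -mulrDl err_yE => errE /(le_trans errE) {}errE.
apply/andP; split; apply: le_trans errE.
  by rewrite lerDl; apply: P0; apply: iidQ_ge0 => y x; exact: Q_ge0.
by rewrite lerDr; apply: P0; exact: iidQ_ge0.
Qed.

End Coding.

Theorem theorem7 (R : realType) (X Y : finType) (Q : X -> Y -> R)
  (Q_ge0 : forall x y, 0 <= Q x y)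
  (Q_sum1 : \sum_(x : X) \sum_(y : Y) Q x y = 1) :
  achievable_region Q = @closure (R * R * R)%type (union_region Q).
Proof.
rewrite closure_union_region//; apply/seteqP.
by split; [exact: achievable_sub|exact: sub_achievable].
Qed.
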